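(* Let $X,Y$ be normed spaces, $q>0$, $S:Y\rightrightarrows X$ a set-valued mapping and $(\bar y,\bar x)\in\mathrm{gph}\,S$. Then $$\mathrm{clm}_q S(\bar y,\bar x)\le\left(\|D_{\frac1q}S(\bar y,\bar x)\|^{+}_{\frac1q}\right)^{-q}.$$ If $\dim X<+\infty$ and $\dim Y<+\infty$, then this inequality holds as equality.
   Context: A set-valued mapping $S:Y\rightrightarrows X$ assigns to each $y\in Y$ a (possibly empty) subset $S(y)\subset X$; $\mathrm{gph}\,S=\{(y,x): x\in S(y)\}$. Isolated calmness: $S$ possesses the $q$-order isolated calmness property at $(\bar y,\bar x)\in\mathrm{gph}\,S$ with modulus $\tau>0$ if there exist neighbourhoods $U$ of $\bar x$ and $V$ of $\bar y$ such that $\tau\|x-\bar x\|^q\le\|y-\bar y\|$ for all $y\in V$ and $x\in S(y)\cap U$. The supremum of all such $\tau>0$ is denoted $\mathrm{clm}_qS(\bar y,\bar x)\in[0,+\infty]$; it equals $0$ if no such $\tau$ exists. For $r>0$, the $r$-order graphical derivative $D_rS(\bar y,\bar x):Y\rightrightarrows X$ is defined by: $x\in D_rS(\bar y,\bar x)(y)$ iff there exist $(y_k,x_k)\to(y,x)$ and $t_k\downarrow0$ with $(\bar y+t_ky_k,\bar x+t_k^rx_k)\in\mathrm{gph}\,S$ for all $k\in\mathbb N$. A mapping $H:Y\rightrightarrows X$ is $r$-order positively homogeneous if $0\in H(0)$ and $H(\lambda y)=\lambda^rH(y)$ for all $y\in Y$, $\lambda>0$ ($D_rS(\bar y,\bar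 x)$ is such a mapping). For such $H$, $\|H\|^+_r:=\sup_{(y,x)\in\mathrm{gph}\,H\setminus\{(0,0)\}}\|x\|/\|y\|^r\in[0,+\infty]$, with $a/0=+\infty$ for $a>0$ and $\sup\emptyset=0$. Conventions: $0^{-q}=+\infty$, $(+\infty)^{-q}=0$. *)

(* Defs.v *)
From mathcomp Require Import all_boot all_order all_algebra.
From mathcomp Require Import all_classical all_reals all_analysis.
Import Order.TTheory GRing.Theory Num.Theory.
Import numFieldNormedType.Exports.

Set Implicit Arguments.
Unset Strict Implicit.
Unset Printing Implicit Defensive.

Local Open Scope classical_set_scope.
Local Open Scope ring_scope.

(* A set-valued mapping from Y to X is a function S : Y -> set X. *)
Definition gph (Y X : Type) (S : Y -> set X) : set (Y * X) :=
  [set p | S p.1 p.2].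

Definition isolated_calm (R : realType) (X Y : normedModType R) (q : R)
    (S : Y -> set X) (ybar : Y) (xbar : X) (tau : R) : Prop :=
  0 < tau /\
  exists (U : set X) (V : set Y), [/\ nbhs xbar U, nbhs ybar V &
    forall y x, V y -> (S y `&` U) x ->
      tau * `|x - xbar| `^ q <= `|y - ybar|].

(* The element 0 is added because the supremum of the empty set is 0 here,
   while [ereal_sup set0 = -oo]. *)
Definition clm (R : realType) (X Y : normedModType R) (q : R)
    (S : Y -> set X) (ybar : Y) (xbar : X) : \bar R :=
  ereal_sup ([set 0%E] `|`
             [set tau%:E | tau in isolated_calm q S ybar xbar]).

Definition graphical_derivative (R : realType) (X Y : normedModType R) (r : R)
    (S : Y -> set X) (ybar : Y) (xbar : X) : Y -> set X :=
  fun y => [set x | exists (y_ : nat -> Y) (x_ : nat -> X) (t_ : nat -> R),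
    [/\ y_ @ \oo --> y, x_ @ \oo --> x,
        (forall k, 0 < t_ k) /\ t_ @ \oo --> (0 : R) &
        forall k, gph S (ybar + t_ k *: y_ k, xbar + (t_ k `^ r) *: x_ k)]].

(* `|x| / `|y| ^ r, with a / 0 = +oo; the case x = y = 0 is never used. *)
Definition norm_ratio (R : realType) (X Y : normedModType R) (r : R)
    (y : Y) (x : X) : \bar R :=
  if y == 0 then +oo%E else (`|x| / `|y| `^ r)%:E.

(* As in [clm], adding 0 encodes that the supremum of the empty set is 0;
   all the ratios are nonnegative. *)
Definition outer_norm (R : realType) (X Y : normedModType R) (r : R)
    (H : Y -> set X) : \bar R :=
  ereal_sup ([set 0%E] `|`
             [set norm_ratio r p.1 p.2 | p in gph H `\ (0, 0)]).

(* a ^ (- q) for a in [0, +oo] and q > 0.  The library's [poweR] is not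
   suitable: it gives 0 ^ (- q) = 0 and (+oo) ^ (- q) = +oo. *)
Definition epow_neg (R : realType) (a : \bar R) (q : R) : \bar R :=
  match a with
  | a'%:E => if a' == 0 then +oo%E else (a' `^ (- q))%:E
  | +oo%E | -oo%E => 0%E
  end.

Definition finite_dimensional (R : realType) (V : lmodType R) : Prop :=
  exists (n : nat) (e : 'I_n -> V),
    forall v, exists c : 'I_n -> R, v = \sum_(i < n) c i *: e i.

(* Main.v *)
Require Import Defs.
From mathcomp Require Import all_boot all_order all_algebra.
From mathcomp Require Import all_classical all_reals all_analysis.
Import Order.TTheory GRing.Theory Num.Theory.
Import numFieldNormedType.Exports.

Local Open Scope classical_set_scope.
Local Open Scope ring_scope.

(** If [tau] is a calmness modulus, passing to the limit in
    [tau * |t^(1/q) x_k|^q <= |t y_k|], where both sides are homogeneous in [t],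
    gives [tau * |x|^q <= |y|] on the graph of the graphical derivative; hence
    the upper bound.  Conversely, if [tau] is not a modulus, there are points
    [(y_n, x_n)] of the graph tending to [(ybar, xbar)] and violating the
    inequality; rescaling by [t_n = |x_n - xbar|^q] puts them in the product of
    the ball of radius [tau] of [Y] and the unit sphere of [X], compact in
    finite dimension, and any cluster point [(y, x)] is in the graph of the
    graphical derivative with [|x| = 1] and [|y| <= tau]. *)

(** * Compactness in finite-dimensional normed spaces *)

Lemma finite_dimensional_basis (R : realType) (V : lmodType R) :
  finite_dimensional V -> exists (n : nat) (e : 'I_n -> V),
    (forall v, exists c : 'I_n -> R, v = \sum_(i < n) c i *: e i) /\
    (forall c : 'I_n -> R, \sum_(i < n) c i *: e i = 0 -> forall i, c i = 0).
Proof.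
case=> n; elim: n => [|n IHn] [e spane].
  by exists 0%N, e; split=> // c _ [].
have [free|] := pselect (forall c : 'I_n.+1 -> R,
  \sum_(i < n.+1) c i *: e i = 0 -> forall i, c i = 0); first by exists n.+1, e.
(* A relation with [c j] nonzero expresses [e j] through the other vectors, so dropping [e j] leaves
   a shorter spanning family for the induction. *)
move=> /existsNP[c /not_implyP[ce0 /existsNP[j /eqP cj0]]].
apply: IHn; exists (e \o lift j) => v.
have [d ->] := spane v.
exists (fun i => d (lift j i) - d j / c j * c (lift j i)).
have ej : e j = - \sum_(i < n) (c j)^-1 *: (c (lift j i) *: e (lift j i)).
  rewrite -scaler_sumr; apply: (scalerI cj0).
  rewrite scalerN scalerA divff// scale1r; apply/eqP; rewrite -addr_eq0.
  rewrite -[X in _ == X]ce0 [X in _ == X](bigD1_ord j)//=.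
rewrite (bigD1_ord j)//= ej scalerN scaler_sumr addrC -sumrB.
by apply: eq_bigr => i _; rewrite scalerBl !scalerA.
Qed.

(** The coordinate map [f] of a basis is continuous, and [|f c|] dominates a positive multiple of
    [|c|]; hence [A] is a closed subset of the image of a compact ball of coordinates. *)
Lemma compact_finite_dimensional (R : realType) (V : normedModType R)
    (A : set V) :
  finite_dimensional V -> bounded_set A -> closed A -> compact A.
Proof.
move=> /finite_dimensional_basis[n [e [spane freee]]] [M [Mreal AM]] clA.
pose f (c : 'rV[R]_n) : V := \sum_(i < n) c ord0 i *: e i.
have fZ a c : f (a *: c) = a *: f c.
  by rewrite /f scaler_sumr; apply: eq_bigr => i _; rewrite mxE scalerA.
have cf : continuous f.
  apply: continuous_big => [|i _ c]; first exact: add_continuous.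
  apply: (@cvgZr_tmp _ _ _ (nbhs c) _ (fun d : 'rV[R]_n => d ord0 i)).
  exact: coord_continuous.
have f0 c : f c = 0 -> c = 0.
  by move=> /freee c0; apply/rowP => i; rewrite c0 mxE.
(* [k] is the minimum of [|f c|] over the unit sphere, positive because [f] has trivial kernel;
   homogeneity extends the bound to all [c]. *)
have [k k0 fk] : exists2 k : R, 0 < k & forall c, k * `|c| <= `|f c|.
  pose K := [set c : 'rV[R]_n | `|c| = 1].
  (* The sphere is empty when there are no coordinates; then [c = 0] always and any [k] works. *)
  have [K0|/set0P K0] := eqVneq K set0.
    exists 1 => // c; have [->|c0] := eqVneq c 0; first by rewrite normr0 mulr0.
    have : K (`|c|^-1 *: c).
      by rewrite /K/= normrZ normfV normr_id mulVf// normr_eq0.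
    by rewrite K0.
  have cK : compact K.
    apply: bounded_closed_compact.
      by exists 1; split => // x x1 c; rewrite /K/= => ->; exact: ltW.
    apply: (@preimage_closed _ _ (fun c : 'rV[R]_n => `|c|) [set 1]).
      by move=> c _; exact: norm_continuous.
    exact: closed_eq.
  have [|c] := @compact_EVT_min _ _ (fun c => `|f c|) _ K0 cK.
    apply: continuous_subspaceT => c.
    apply: (@continuous_comp _ _ _ f Num.norm); first exact: cf.
    exact: norm_continuous.
  rewrite inE => Kc minc; exists `|f c|.
    rewrite normr_gt0; apply/eqP => /f0 c0.
    by move/eqP: Kc; rewrite c0 normr0 eq_sym oner_eq0.
  move=> d; have [->|d0] := eqVneq d 0; first by rewrite normr0 mulr0.
  have := minc (`|d|^-1 *: d); rewrite inE fZ normrZ normfV normr_id mulrC.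
  rewrite ler_pdivlMr ?normr_gt0//; apply.
  by rewrite /K/= normrZ normfV normr_id mulVf// normr_eq0.
(* [bounded_set] bounds the norms on [A] by every number strictly above [M], hence [M + 1]. *)
pose B := [set c : 'rV[R]_n | `|c| <= (M + 1) / k].
have cB : compact B.
  apply: bounded_closed_compact.
    exists ((M + 1) / k); split; first exact: num_real.
    by move=> x xM c /le_trans; apply; exact: ltW.
  apply: (@preimage_closed _ _ (fun c : 'rV[R]_n => `|c|)
    [set x | x <= (M + 1) / k]); last exact: closed_le.
  by move=> c _; exact: norm_continuous.
apply: (subclosed_compact clA (continuous_compact (continuous_subspaceT cf) cB)).
move=> v Av; have [c vE] := spane v.
have vf : f (\row_i c i) = v.
  by rewrite vE; apply: eq_bigr => i _; rewrite mxE.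
exists (\row_i c i) => //; rewrite /B/= ler_pdivlMr// mulrC.
by rewrite (le_trans (fk _))// vf AM// ltrDl.
Qed.

(** A cluster point has, for each [n], a term of index at least [n] within 1/(n+1) of it; choosing
    such indices gives [phi], which [n <= phi n] sends to infinity. *)
Lemma compact_subsequence (R : realType) (T : pseudoMetricType R) (A : set T)
    (u : nat -> T) :
  compact A -> (forall n, A (u n)) ->
  exists (l : T) (phi : nat -> nat), [/\ A l, forall n, (n <= phi n)%N &
    u (phi n) @[n --> \oo] --> l].
Proof.
move=> cA Au.
have [|l [Al ul]] := cA (fmap u \oo) _; first by exists 0%N => // n _; exact: Au.
have near_l n : exists m, (n <= m)%N /\ ball l n.+1%:R^-1 (u m).
  have [||_ [[m /= nm <-] lm]] := ul (u @` [set m | (n <= m)%N])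
      (ball l n.+1%:R^-1); last by exists m.
    by exists n => // m nm; exists m.
  by apply: nbhsx_ballx; rewrite invr_gt0 ltr0n.
have [phi phiP] := choice near_l.
exists l, phi; split=> // [n|]; first by have [] := phiP n.
apply/cvg_ballP => e e0; near=> n; have [_] := phiP n.
apply: le_ball; apply: ltW; near: n.
exact: (near_infty_natSinv_lt (PosNum e0)).
Unshelve. all: by end_near. Qed.

(** * Calmness moduli and the graphical derivative *)

Lemma cvg_powR0 (R : realType) (r : R) (t : nat -> R) :
  0 < r -> (forall k, 0 < t k) -> t @ \oo --> (0 : R) ->
  (t k) `^ r @[k --> \oo] --> (0 : R).
Proof.
move=> r0 t0 tcvg; have /cvg_at_rightP := powR_cvg0 r0; exact.
Qed.

Lemma isolated_calm_graphical_derivative (R : realType)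
    (X Y : normedModType R) (q : R) (S : Y -> set X) (ybar : Y) (xbar : X)
    (tau : R) (y : Y) (x : X) :
  0 < q -> isolated_calm q S ybar xbar tau ->
  graphical_derivative q^-1 S ybar xbar y x -> tau * `|x| `^ q <= `|y|.
Proof.
move=> q0 [tau0 [U [V [nU nV UV]]]] [y_ [x_ [t_ [cy cx [t0 ct] tS]]]].
have qV0 : 0 < q^-1 by rewrite invr_gt0.
(* The slack [e] makes [|y_ k| < b] eventually, so only [|x_ k|] passes to the limit, against the
   constant (b / tau)^(1/q). *)
apply/ler_addgt0Pr => e e0; set b := _ + e.
have b0 : 0 < b / tau by rewrite divr_gt0// ltr_wpDl.
suff xb : `|x| <= (b / tau) `^ q^-1.
  rewrite mulrC -ler_pdivlMr// -[leRHS]powRr1 ?(ltW b0)// -(@mulVf _ q) ?gt_eqF//.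
  by rewrite powRrM ge0_ler_powR ?nnegrE ?powR_ge0 ?(ltW q0).
apply: (ler_cvg_to (cvg_norm cx) (cvg_cst _)).
have cV : ybar + t_ k *: y_ k @[k --> \oo] --> ybar.
  rewrite -[X in _ --> X]addr0 -(scale0r y).
  by apply: cvgD; [exact: cvg_cst|exact: cvgZ].
have cU : xbar + t_ k `^ q^-1 *: x_ k @[k --> \oo] --> xbar.
  rewrite -[X in _ --> X]addr0 -(scale0r x).
  by apply: cvgD; [exact: cvg_cst|apply: cvgZ => //; exact: cvg_powR0].
near=> k.
have Vk : V (ybar + t_ k *: y_ k) by near: k; exact: cV.
have Uk : U (xbar + t_ k `^ q^-1 *: x_ k) by near: k; exact: cU.
have ykb : `|y_ k| < b.
  by near: k; apply: (cvgr_lt _ (cvg_norm cy)); rewrite ltrDl.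
have := UV _ _ Vk (conj (tS k) Uk).
(* As (t^(1/q))^q = t, the factor [t_ k] appears on both sides and cancels. *)
rewrite /= ![_ + _ *: _]addrC !addrK !normrZ (gtr0_norm (t0 k)).
rewrite ger0_norm ?powR_ge0// powRM ?powR_ge0// -powRrM mulVf ?gt_eqF//.
rewrite powRr1 ?(ltW (t0 k))// mulrCA ler_pM2l// => xy.
rewrite -[leLHS]powRr1// -(@mulfV _ q) ?gt_eqF// powRrM.
rewrite ge0_ler_powR ?nnegrE ?powR_ge0 ?(ltW qV0) ?(ltW b0)//.
by rewrite ler_pdivlMr// mulrC ltW// (le_lt_trans xy).
Unshelve. all: by end_near. Qed.

Lemma not_isolated_calm_graphical_derivative (R : realType)
    (X Y : normedModType R) (q : R) (S : Y -> set X) (ybar : Y) (xbar : X)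
    (tau : R) :
  finite_dimensional X -> finite_dimensional Y -> 0 < q -> 0 < tau ->
  ~ isolated_calm q S ybar xbar tau ->
  exists y x, [/\ graphical_derivative q^-1 S ybar xbar y x,
    `|x| = 1 & `|y| <= tau].
Proof.
move=> fX fY q0 tau0 ncalm.
have qV0 : 0 < q^-1 by rewrite invr_gt0.
have bad n : exists p : Y * X, [/\ `|p.1 - ybar| < n.+1%:R^-1,
    `|p.2 - xbar| < n.+1%:R^-1, S p.1 p.2 &
    `|p.1 - ybar| < tau * `|p.2 - xbar| `^ q].
  apply: contrapT => nbad; apply: ncalm; split=> //.
  exists (ball xbar n.+1%:R^-1), (ball ybar n.+1%:R^-1); split.
  - by apply: nbhsx_ballx; rewrite invr_gt0 ltr0n.
  - by apply: nbhsx_ballx; rewrite invr_gt0 ltr0n.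
  move=> y x; rewrite -!ball_normE /= => Vy [Sx Ux].
  rewrite leNgt; apply/negP => lt; apply: nbad; exists (y, x).
  by split=> //=; rewrite distrC.
have [p pP] := choice bad.
pose t n := `|(p n).2 - xbar| `^ q.
(* The violated inequality is strict, so its right-hand side is positive; at [xbar] it would vanish,
   since 0^q = 0 for nonzero [q]. *)
have d0 n : 0 < `|(p n).2 - xbar|.
  rewrite normr_gt0; apply/eqP => x0; have [_ _ _] := pP n.
  by rewrite x0 normr0 powR0 ?gt_eqF// mulr0 ltNge normr_ge0.
have t0 n : 0 < t n by exact: powR_gt0.
have tV n : t n `^ q^-1 = `|(p n).2 - xbar|.
  by rewrite -powRrM mulfV ?gt_eqF// powRr1.
(* By [tV], the two scalings are those of the graphical derivative, so undoing them returns the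
   graph points [p n] exactly. *)
pose w n : Y * X := ((t n)^-1 *: ((p n).1 - ybar),
  `|(p n).2 - xbar|^-1 *: ((p n).2 - xbar)).
pose A := [set y : Y | `|y| <= tau].
pose B := [set x : X | `|x| = 1].
have cA : compact A.
  apply: compact_finite_dimensional => //.
    exists tau; split; first exact: num_real.
    by move=> z tz y /le_trans; apply; exact: ltW.
  apply: (@preimage_closed _ _ (fun y : Y => `|y|) [set z | z <= tau]).
    by move=> y _; exact: norm_continuous.
  exact: closed_le.
have cB : compact B.
  apply: compact_finite_dimensional => //.
    by exists 1; split => // z z1 x; rewrite /B/= => ->; exact: ltW.
  apply: (@preimage_closed _ _ (fun x : X => `|x|) [set 1]).
    by move=> x _; exact: norm_continuous.
  exact: closed_eq.
have wAB n : (A `*` B) (w n).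
  split; rewrite /A /B /w /= normrZ normfV ?normr_id ?mulVf ?gt_eqF//.
  rewrite (gtr0_norm (t0 n)) mulrC ler_pdivrMr//.
  by have [_ _ _ /ltW] := pP n.
have [[y x] [phi [[/= yA xB] phin cw]]] :=
  compact_subsequence _ _ _ _ (compact_setX cA cB) wAB.
exists y, x; split=> //.
exists (fun n => (w (phi n)).1), (fun n => (w (phi n)).2), (t \o phi).
split.
- apply: (cvg_comp _ _ cw); exact: cvg_fst.
- apply: (cvg_comp _ _ cw); exact: cvg_snd.
- split=> [n|]; first exact: t0.
  apply: (@cvg_powR0 _ _ (fun n => `|(p (phi n)).2 - xbar|)) => //.
  (* From [n <= phi n], the distance is at most 1/(phi n + 1) <= 1/(n+1). *)
  apply: (squeeze_cvgr _ (cvg_cst 0) cvg_harmonic).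
  apply: nearW => n; rewrite normr_ge0 /=.
  have [_ /ltW/le_trans -> //] := pP (phi n).
  by rewrite lef_pV2 ?posrE ?ltr0n// ler_nat ltnS.
move=> n; have [_ _ Sp _] := pP (phi n); rewrite /gph /= tV.
by rewrite !scalerA !divff ?gt_eqF// !scale1r !subrKC.
Qed.

(** * Negative powers on [0, +oo] and the outer norm *)

Lemma le_epow_neg (R : realType) (a : \bar R) (q tau : R) :
  0 < q -> 0 < tau -> (0 <= a)%E ->
  (a <= (tau `^ (- q^-1))%:E)%E -> (tau%:E <= epow_neg a q)%E.
Proof.
move=> q0 tau0; case: a => [a||] //; rewrite !lee_fin /= => a0 atau.
case: eqP => [_|/eqP an0]; first by rewrite leey.
have {an0}a0 : 0 < a by rewrite lt_neqAle eq_sym an0.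
rewrite lee_fin !powRN in atau *.
(* After inversion the goal is a^q <= 1/tau, the q-th power of the hypothesis. *)
rewrite -[tau]invrK lef_pV2 ?posrE ?invr_gt0 ?powR_gt0//.
have -> : tau^-1 = (tau `^ q^-1)^-1 `^ q.
  by rewrite -powRN -powRrM mulNr mulVf ?gt_eqF// powRN powRr1// ltW.
by rewrite ge0_ler_powR ?nnegrE ?invr_ge0 ?powR_ge0 ?(ltW q0) ?(ltW a0).
Qed.

Lemma epow_neg_le (R : realType) (a : \bar R) (q tau : R) :
  0 < q -> 0 < tau ->
  ((tau `^ (- q^-1))%:E <= a)%E -> (epow_neg a q <= tau%:E)%E.
Proof.
move=> q0 tau0; case: a => [a||] /= taua; [|by rewrite lee_fin ltW..].
rewrite lee_fin in taua.
have a0 : 0 < a by apply: lt_le_trans taua; exact: powR_gt0.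
rewrite gt_eqF// lee_fin !powRN in taua *.
rewrite -[leRHS]invrK lef_pV2 ?posrE ?invr_gt0 ?powR_gt0//.
have -> : tau^-1 = (tau `^ q^-1)^-1 `^ q.
  by rewrite -powRN -powRrM mulNr mulVf ?gt_eqF// powRN powRr1// ltW.
by rewrite ge0_ler_powR ?nnegrE ?invr_ge0 ?powR_ge0 ?(ltW q0) ?(ltW a0).
Qed.

Lemma epow_neg_ge0 (R : realType) (a : \bar R) (q : R) :
  (0 <= epow_neg a q)%E.
Proof. by case: a => [a||] //=; case: ifP => // _; rewrite lee_fin powR_ge0. Qed.

Lemma outer_norm_ge0 (R : realType) (X Y : normedModType R) (r : R)
    (H : Y -> set X) : (0 <= outer_norm r H)%E.
Proof. by apply: ereal_sup_ubound; left. Qed.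

Lemma clm_ge0 (R : realType) (X Y : normedModType R) (q : R)
    (S : Y -> set X) (ybar : Y) (xbar : X) : (0 <= clm q S ybar xbar)%E.
Proof. by apply: ereal_sup_ubound; left. Qed.

Lemma outer_norm_graphical_derivative_le (R : realType)
    (X Y : normedModType R) (q : R) (S : Y -> set X) (ybar : Y) (xbar : X)
    (tau : R) :
  0 < q -> isolated_calm q S ybar xbar tau ->
  (outer_norm q^-1 (graphical_derivative q^-1 S ybar xbar) <=
     (tau `^ (- q^-1))%:E)%E.
Proof.
move=> q0 calm; have [tau0 _] := calm.
apply: ge_ereal_sup => _ [->|[[y x] [/= Dyx yx0] <-]].
  by rewrite lee_fin powR_ge0.
have := isolated_calm_graphical_derivative
  _ _ _ _ _ _ _ _ _ _ q0 calm Dyx.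
rewrite /norm_ratio; have [y0|y0 xy] := eqVneq y 0.
  (* For [y = 0] the estimate forces [x = 0], contradicting that the pair is nonzero; so the ratio
     [+oo] never occurs. *)
  rewrite y0 normr0 pmulr_rle0// => x0; exfalso; apply: yx0; congr pair => //.
  apply/eqP; rewrite -normr_eq0; apply/eqP; apply: (@powR_eq0_eq0 _ _ q).
  by apply/eqP; rewrite eq_le x0 powR_ge0.
rewrite lee_fin ler_pdivrMr ?powR_gt0 ?normr_gt0// powRN mulrC.
rewrite ler_pdivlMr ?powR_gt0// mulrC.
have -> : tau `^ q^-1 * `|x| = (tau * `|x| `^ q) `^ q^-1.
  by rewrite powRM ?powR_ge0 ?(ltW tau0)// -powRrM mulfV ?gt_eqF// powRr1.
by rewrite ge0_ler_powR ?nnegrE ?invr_ge0 ?mulr_ge0 ?powR_ge0 ?(ltW q0)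
  ?(ltW tau0).
Qed.

Theorem corollary3p8 (R : realType) (X Y : normedModType R) (q : R)
    (q_gt0 : 0 < q) (S : Y -> set X) (ybar : Y) (xbar : X)
    (gphS : gph S (ybar, xbar)) :
  (clm q S ybar xbar <=
     epow_neg (outer_norm q^-1 (graphical_derivative q^-1 S ybar xbar)) q)%E
  /\ (finite_dimensional X -> finite_dimensional Y ->
      clm q S ybar xbar =
        epow_neg (outer_norm q^-1 (graphical_derivative q^-1 S ybar xbar)) q).
Proof.
set N := outer_norm _ _.
have clm_le : (clm q S ybar xbar <= epow_neg N q)%E.
  apply: ge_ereal_sup => _ [->|[tau calm <-]]; first exact: epow_neg_ge0.
  have [tau0 _] := calm; apply: le_epow_neg => //; first exact: outer_norm_ge0.
  exact: outer_norm_graphical_derivative_le.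
split=> // fX fY; apply/eqP; rewrite eq_le clm_le /=.
(* A real [tau] above the supremum is not a modulus, so the derivative contains a pair with
   [|x| = 1] and [|y| <= tau], whose ratio is at least tau^(-1/q). *)
have le_tau tau : (clm q S ybar xbar < tau%:E)%E -> (epow_neg N q <= tau%:E)%E.
  move=> clm_tau; have tau0 : 0 < tau.
    by rewrite -lte_fin (le_lt_trans (clm_ge0 _ _ _ _ _ _ _) clm_tau).
  have [y [x [Dyx x1 ytau]]] : exists y x,
      [/\ graphical_derivative q^-1 S ybar xbar y x, `|x| = 1 & `|y| <= tau].
    apply: not_isolated_calm_graphical_derivative => // calm.
    move: clm_tau; rewrite ltNge => /negP; apply.
    by apply: ereal_sup_ubound; right; exists tau.
  apply: epow_neg_le => //.
  apply: (@le_trans _ _ (norm_ratio q^-1 y x)); last first.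
    apply: ereal_sup_ubound; right; exists (y, x) => //; split=> // -[_ x0].
    by move/eqP: x1; rewrite x0 normr0 eq_sym oner_eq0.
  rewrite /norm_ratio; case: eqP => [_|/eqP y0]; first by rewrite leey.
  rewrite lee_fin x1 div1r powRN lef_pV2 ?posrE ?powR_gt0 ?normr_gt0//.
  by rewrite ge0_ler_powR ?nnegrE ?invr_ge0// ltW.
(* A finite supremum [c] is approached from above by [tau = c + e]; the value [+oo] is immediate,
   and [-oo] is excluded by nonnegativity. *)
move: (clm_ge0 _ _ _ q S ybar xbar) le_tau.
case: (clm q S ybar xbar) => [c||] // _ le_tau; last by rewrite leey.
by apply/lee_addgt0Pr => e e0; apply: le_tau; rewrite lte_fin ltrDl.
Qed.
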